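(* Let $p\in(0,1)$ be a constant and $b=\frac{1}{1-p}$. Finding a maximal matching of $G_p$ for $n$-vertex stochastic graphs $G$ with realization probability $p$ requires $\Omega(n\log_b n)$ total queries; i.e., there are $n$-vertex graphs $G$ for which any set $Q$ of queried edges whose realized edges $Q\cap E(G_p)$ are guaranteed to contain a maximal matching of $G_p$ must have $|Q|=\Omega(n\log_b n)$.
   Context: $G_p$ is the random subgraph of $G$ containing each edge independently with probability $p$. Queries are chosen non-adaptively; querying an edge reveals whether it is in $G_p$. A maximal matching of a graph is a matching to which no further edge of the graph can be added. *)

(* Defs.v *)
From mathcomp Require Import all_boot all_order all_algebra.
From mathcomp Require Import reals exp.

Set Implicit Arguments.
Unset Strict Implicit.
Unset Printing Implicit Defensive.

Import Order.TTheory GRing.Theory Num.Theory.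

Local Open Scope ring_scope.

(* A simple graph on the vertex type V is given by its edge set, whose members
   are two-element sets of vertices. *)
Definition simple_graph (V : finType) (E : {set {set V}}) : bool :=
  [forall e in E, #|e| == 2].

(* [trivIset] is disjointness of distinct members: no two edges of M share a
   vertex. *)
Definition matching (V : finType) (H M : {set {set V}}) : bool :=
  (M \subset H) && trivIset M.

Definition maximal_matching (V : finType) (H M : {set {set V}}) : bool :=
  matching H M && [forall e in H :\: M, ~~ matching H (e |: M)].

(* The probability that G_p is exactly the subgraph of G with edge set S,
   for S a subset of the edge set E of G: each edge of G is present
   independently with probability p. *)
Definition pr_realization (R : realType) (V : finType) (p : R)
    (E S : {set {set V}}) : R :=
  \prod_(e in E) (if e \in S then p else 1 - p).

Definition pr_Gp (R : realType) (V : finType) (p : R) (E : {set {set V}})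
    (A : pred {set {set V}}) : R :=
  \sum_(S in powerset E | A S) pr_realization p E S.

(* S is the edge set of G_p, so Q :&: S is the set of queried edges that are
   revealed to be realized. *)
Definition queries_find_maximal_matching (V : finType)
    (Q S : {set {set V}}) : bool :=
  [exists M : {set {set V}}, (M \subset Q :&: S) && maximal_matching S M].

Definition logb (R : realType) (b x : R) : R := ln x / ln b.

(* Main.v *)
(* G is the complete graph. If |Q| is small, at least half of the vertices have
   Q-degree at most d, where d is about (log_b n) / 4. Among them one greedily
   picks k unqueried pairs e = {u, v}, with no Q-edge joining two different pairs,
   where k is of order n / d. If for some e the edge e is realized but no Q-edge
   at u or v is, then no matching inside Q is maximal, since e can be added. These
   events depend on disjoint sets of edges, so they are independent, and each has
   probability at least q = p (1 - p)^(2d). Writing x = b^d, so that x^4 <= n < (b x)^4,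
   one has q = p / x^2, hence k q is at least of order x, and (1 - q)^k tends to 0. *)

Require Import Defs.
From mathcomp Require Import all_boot all_order all_algebra.
From mathcomp Require Import reals exp.
From mathcomp Require Import zify ring lra.

Import Order.TTheory GRing.Theory Num.Theory.
Local Open Scope ring_scope.

(** * Product measure on the subgraphs of a graph *)

Section RandomSubgraph.
Context {R : realType} {V : finType}.
Implicit Types (p : R) (E S : {set {set V}}) (A B : pred {set {set V}}).

Lemma pr_realization_ge0 p E S : 0 <= p -> p <= 1 -> 0 <= pr_realization p E S.
Proof. by move=> p0 p1; apply: prodr_ge0 => e _; case: ifP; rewrite ?subr_ge0. Qed.

Lemma pr_Gp_le p E A B : 0 <= p -> p <= 1 -> (forall S, A S -> B S) ->
  pr_Gp p E A <= pr_Gp p E B.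
Proof.
move=> p0 p1 AB; rewrite /pr_Gp big_mkcondr [leRHS]big_mkcondr /=.
apply: ler_sum => S _; case: ifPn => [/AB -> //|_].
by case: ifP => // _; apply: pr_realization_ge0.
Qed.

(** Independence over disjoint edge sets: a subset of [E1 :|: E2] splits uniquely into its traces on
    [E1] and [E2], and its weight is the product of theirs. *)
Lemma pr_Gp_setU p E1 E2 A B : [disjoint E1 & E2] ->
  pr_Gp p (E1 :|: E2) (fun S => A (S :&: E1) && B (S :&: E2)) =
  pr_Gp p E1 A * pr_Gp p E2 B.
Proof.
move=> dis; have E12 : E1 :&: E2 = set0 by apply/eqP; rewrite setI_eq0.
rewrite /pr_Gp big_distrlr /= pair_big /=.
rewrite (reindex_onto (fun S12 : {set {set V}} * {set {set V}} => S12.1 :|: S12.2)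
  (fun S => (S :&: E1, S :&: E2))) /=; last first.
  move=> S /andP[]; rewrite powersetE => /setIidPl SE _.
  by rewrite -setIUr.
have capL (S1 S2 : {set {set V}}) : S1 \subset E1 -> S2 \subset E2 ->
    (S1 :|: S2) :&: E1 = S1.
  move=> s1 s2; rewrite setIUl (setIidPl s1); apply/setUidPl.
  by apply: subset_trans (setSI _ s2) _; rewrite setIC E12 sub0set.
have capR (S1 S2 : {set {set V}}) : S1 \subset E1 -> S2 \subset E2 ->
    (S1 :|: S2) :&: E2 = S2.
  move=> s1 s2; rewrite setIUl (setIidPl s2); apply/setUidPr.
  by apply: subset_trans (setSI _ s1) _; rewrite E12 sub0set.
apply: eq_big => [[S1 S2]|[S1 S2]] /=.
  rewrite !powersetE; apply/idP/idP.
    case/andP=> /andP[_ /andP[a b]] /eqP[e1 e2].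
    by rewrite -{1}e1 -{2}e2 !subsetIr; move: a b; rewrite e1 e2 => -> ->.
  case/andP=> /andP[s1 a] /andP[s2 b].
  by rewrite capL // capR // a b eqxx setUSS.
case/andP=> _ /eqP[e1 e2].
rewrite /pr_realization (eq_bigl [predU E1 & E2]) => [|e]; last by rewrite !inE.
rewrite bigU //=; congr (_ * _).
  by apply: eq_bigr => e eE; rewrite -[in RHS]e1 [in RHS]inE eE andbT.
by apply: eq_bigr => e eE; rewrite -[in RHS]e2 [in RHS]inE eE andbT.
Qed.

Lemma pr_Gp_total p E : pr_Gp p E xpredT = 1.
Proof.
(* Factors for [e] present and absent. Outside [E] they are 0 and 1, so in the expanded product
   every [S] not contained in [E] contributes 0. *)
pose F e := if e \in E then p else 0; pose G e := if e \in E then 1 - p else 1.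
transitivity (\prod_e (F e + G e)); last first.
  by apply: big1 => e _; rewrite /F /G; case: ifP => _; rewrite ?add0r ?subrKC.
rewrite bigA_distr /pr_Gp [LHS]big_mkcond [RHS]big_mkcond /=.
apply: eq_bigr => S _; rewrite andbT powersetE.
have [SE|/subsetPn[e eS eE]] := boolP (S \subset E); last first.
  by rewrite (bigD1 e) //= eS /F (negPf eE) mul0r.
rewrite /pr_realization big_mkcond /=; apply: eq_bigr => e _.
by rewrite /F /G; have [eS|] := boolP (e \in S); first by rewrite (subsetP SE).
Qed.

Lemma pr_Gp_neq_set1 p E e : e \in E ->
  pr_Gp p E (fun S => S != [set e]) = 1 - p * (1 - p) ^+ #|E|.-1.
Proof.
move=> eE; rewrite -[X in X - _](pr_Gp_total p E) /pr_Gp.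
rewrite [in RHS](bigD1 [set e]) /=; last by rewrite powersetE sub1set eE.
have -> : pr_realization p E [set e] = p * (1 - p) ^+ #|E|.-1.
  rewrite /pr_realization (bigD1 e) //= inE eqxx; congr (_ * _).
  rewrite (eq_bigr (fun _ => 1 - p)) => [|f /andP[_ fe]]; last by rewrite inE (negPf fe).
  rewrite prodr_const; congr (_ ^+ _).
  rewrite [in RHS](cardD1 e) eE /=; apply: eq_card => f.
  by rewrite !inE andbC.
by rewrite [RHS]addrC addKr; apply: eq_bigl => S; rewrite andbT.
Qed.

(** Induction on [s]: the head event depends only on [F e] and the others only on [E :\: F e], so
    the probabilities multiply. Besides [e], at most [D] edges of [F e] have to be absent, whence
    the exponent. *)
Lemma pr_Gp_all_neq_set1 p E (F : {set V} -> {set {set V}}) D (s : seq {set V}) :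
  0 <= p -> p <= 1 ->
  {in s, forall e, [/\ e \in F e, F e \subset E & (#|F e| <= D.+1)%N]} ->
  pairwise (fun e f => [disjoint F e & F f]) s ->
  pr_Gp p E (fun S => all (fun e => S :&: F e != [set e]) s)
    <= (1 - p * (1 - p) ^+ D) ^+ size s.
Proof.
move=> p0 p1; elim: s E => [|e s IH] E sF /=; first by rewrite pr_Gp_total.
case/andP=> /allP dis pw.
have [eF FE cF] := sF e (mem_head e s).
have {}sF : {in s, forall f, [/\ f \in F f, F f \subset E :\: F e & (#|F f| <= D.+1)%N]}.
  move=> f fs; have := sF f; rewrite inE fs orbT => /(_ isT)[fF fE cf]; split=> //.
  by rewrite subsetD fE disjoint_sym dis.
have {1}-> : E = F e :|: E :\: F e by rewrite -{1}(setID E (F e)) (setIidPr FE).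
apply: le_trans (_ : pr_Gp p (F e :|: E :\: F e) (fun S => (S :&: F e != [set e]) &&
    all (fun f => S :&: (E :\: F e) :&: F f != [set f]) s) <= _).
  apply: pr_Gp_le => // S /andP[-> /allP al] /=; apply/allP => f fs.
  by have [_ fE _] := sF f fs; rewrite -setIA (setIidPr fE) al.
rewrite (pr_Gp_setU p (F e) _ (fun S => S != [set e])
  (fun S => all (fun f => S :&: F f != [set f]) s)); last first.
  by rewrite disjoints_subset setCD subsetUr.
rewrite exprS pr_Gp_neq_set1 //.
have q1 k : p * (1 - p) ^+ k <= 1.
  by rewrite mulr_ile1 ?exprn_ge0 ?exprn_ile1 ?subr_ge0 // gerBl.
apply: ler_pM; rewrite ?subr_ge0 ?q1 //.
- by apply: sumr_ge0 => S _; apply: pr_realization_ge0.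
- rewrite lerD2l lerN2 ler_wpM2l // ler_wiXn2l ?subr_ge0 ?gerBl //.
  by rewrite -ltnS (leq_trans _ cF) // ltn_predL; apply/card_gt0P; exists e.
- exact: IH.
Qed.

End RandomSubgraph.

(** * Degrees in the query graph and separated unqueried pairs *)

Section Matching.
Context {V : finType}.
Implicit Types (L : {set V}) (Q S E : {set {set V}}) (e f : {set V}) (u v : V).

Definition edges_meeting Q e : {set {set V}} := [set f in Q | ~~ [disjoint f & e]].

(** A matching made of queried realized edges has no edge meeting [e], so the realized edge [e] can
    still be added to it. *)
Lemma queries_fail Q S e : e \in S -> e \notin Q -> e != set0 ->
  S :&: (e |: edges_meeting Q e) = [set e] ->
  ~~ queries_find_maximal_matching Q S.
Proof.
move=> eS eQ e0 Se; apply/existsPn => M; apply/negP => /andP[].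
rewrite subsetI => /andP[MQ MS] /andP[/andP[_ tM] /forallP/(_ e)].
have eM : e \notin M by apply: contra eQ => /(subsetP MQ).
rewrite !inE eM eS /= => /negP; apply.
rewrite /matching subUset sub1set eS MS /=.
have dis f : f \in M -> [disjoint e & f].
  move=> fM; apply/negPn/negP => nd.
  have : f \in S :&: (e |: edges_meeting Q e).
    by rewrite !inE (subsetP MS) // (subsetP MQ) //= disjoint_sym nd orbT.
  by rewrite Se inE => /eqP fe; rewrite -fe fM in eM.
apply/trivIsetP => f g; rewrite !inE.
case/orP=> [/eqP->|fM] /orP[/eqP->|gM]; rewrite ?eqxx // => fg.
- exact: dis.
- by rewrite disjoint_sym dis.
- by move/trivIsetP: tM; apply.
Qed.

Definition degree Q v := #|[set f in Q | v \in f]|.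

Lemma card_edges_meeting2 Q u v :
  (#|edges_meeting Q [set u; v]| <= degree Q u + degree Q v)%N.
Proof.
apply: leq_trans (leq_card_setU _ _); apply: subset_leq_card.
apply/subsetP => f; rewrite !inE => /andP[-> /=].
case/pred0Pn=> w /=; rewrite !inE => /andP[wf /orP[] /eqP <-];
by rewrite wf ?orbT.
Qed.

(** The map from [w] to [[set u; w]] is injective, the case [w = u] included. *)
Lemma card_neighbours Q u : (#|[set w | [set u; w] \in Q]| <= degree Q u)%N.
Proof.
rewrite -(@card_in_imset _ _ (fun w => [set u; w])) => [|w w' _ _ eq_uw]; last first.
  have := set22 u w; rewrite eq_uw !inE => /orP[/eqP wu|/eqP //].
  by have := set22 u w'; rewrite -eq_uw wu !inE orbb => /eqP.
apply: subset_leq_card; apply/subsetP => _ /imsetP[w wQ ->].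
by move: wQ; rewrite !inE eqxx => ->.
Qed.

Lemma sum_degree Q : {in Q, forall e, #|e| = 2} -> (\sum_v degree Q v = #|Q| * 2)%N.
Proof.
move=> Q2; rewrite /degree.
under eq_bigr do rewrite -sum1_card.
under eq_bigr do (under eq_bigl do rewrite inE; rewrite big_mkcondr).
rewrite exchange_big /=.
under eq_bigr => e eQ do rewrite -big_mkcond /= sum1_card Q2 //.
by rewrite sum_nat_const.
Qed.

(** Markov's inequality: each remaining vertex contributes at least [d.+1] to the degree sum, which
    is twice [#|Q|]. *)
Lemma card_low_degree Q d : {in Q, forall e, #|e| = 2} ->
  (#|V| * d.+1 <= #|[set v | (degree Q v <= d)%N]| * d.+1 + #|Q| * 2)%N.
Proof.
move=> Q2; set L := [set v | _].
rewrite -(cardsC L) mulnDl leq_add2l -sum_degree // -sum_nat_const.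
rewrite [leqRHS](bigID (mem (~: L))) /=.
apply: leq_trans (leq_addr _ _); apply: leq_sum => v.
by rewrite !inE -ltnNge.
Qed.

(** Greedy choice: pick [u], delete its closed neighbourhood, pick [v] among the rest, delete its
    closed neighbourhood, and recurse. Each deletion removes at most [d.+1] vertices, so a pair
    costs [2 * d.+1]. *)
Lemma separated_nonedges Q d k L : {in Q, forall e, #|e| = 2} ->
  {in L, forall v, (degree Q v <= d)%N} -> (k * (2 * d.+1) <= #|L|)%N ->
  exists s : seq {set V}, [/\ size s = k,
    {in s, forall e, exists u v,
       [/\ e = [set u; v], u \in L, v \in L, u != v & e \notin Q]} &
    pairwise (fun e f => [disjoint e |: edges_meeting Q e
                                 & f |: edges_meeting Q f]) s].
Proof.
move=> Q2; elim: k L => [|k IH] L degL kL; first by exists nil.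
pose N u := u |: [set w | [set u; w] \in Q].
have cN u : u \in L -> (#|N u| <= d.+1)%N.
  move=> uL; rewrite /N cardsU1 -add1n leq_add ?leq_b1 //.
  exact: leq_trans (card_neighbours Q u) (degL u uL).
have cD (A B : {set V}) m : (#|B| <= d.+1 -> m + d.+1 <= #|A| -> m <= #|A :\: B|)%N.
  move=> cB cA; rewrite cardsD leq_subRL.
    by rewrite addnC (leq_trans _ cA) // leq_add2l (leq_trans _ cB) // subset_leq_card // subsetIr.
  by rewrite subset_leq_card // subsetIl.
have /card_gt0P[u uL] : (0 < #|L|)%N by apply: leq_trans kL; rewrite mulSn; lia.
have c1 : (k * (2 * d.+1) + d.+1 <= #|L :\: N u|)%N.
  by apply: cD (cN u uL) _; apply: leq_trans kL; lia.
have /card_gt0P[v] : (0 < #|L :\: N u|)%N by apply: leq_trans c1; lia.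
rewrite !inE negb_or => /andP[/andP[vu uvQ] vL].
have := cD _ _ _ (cN v vL) c1; set L' := L :\: N u :\: N v => c2.
have sL' : L' \subset L by rewrite /L' !subDset; apply/subsetP=> x xL; rewrite !inE xL !orbT.
have [|s [ss sE sP]] := IH L' _ c2; first by move=> w /(subsetP sL'); apply: degL.
have N' a b : a \in [set u; v] -> b \in L' -> (a != b) && ([set a; b] \notin Q).
  rewrite /L' /N !inE !negb_or => auv /andP[/andP[bv vbQ] /andP[/andP[bu ubQ] _]].
  by case/orP: auv => /eqP ->; rewrite eq_sym ?bu ?bv.
exists ([set u; v] :: s); split=> /=; first by rewrite ss.
- move=> e; rewrite inE => /orP[/eqP ->|/sE[a [b [-> aL bL ab abQ]]]].
    by exists u, v; split=> //; rewrite eq_sym.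
  by exists a, b; split=> //; apply: (subsetP sL').
rewrite sP andbT; apply/allP => e' /sE[a [b [-> aL bL ab abQ]]] /=.
have ab' c : c \in [set a; b] -> c \in L' by rewrite in_set2 => /orP[] /eqP ->.
rewrite -setI_eq0; apply/eqP/setP => f; rewrite in_set0; apply/negP.
(* A common member [f] is one of the two pairs or a queried edge meeting both. In the last case [f]
   has two elements, so it joins [u] or [v] to a vertex of [L'], which [N'] forbids. *)
case/setIP=> /setU1P[->|fuv] /setU1P[euv|].
- have := N' a a; rewrite euv set21 => /(_ isT aL).
  by rewrite eqxx.
- by rewrite inE (negPf uvQ).
- by move: fuv; rewrite inE euv (negPf abQ).
rewrite inE => /andP[fQ /pred0Pn[y /= /andP[yf /ab' yL]]].
move: fuv; rewrite inE => /andP[_ /pred0Pn[x /= /andP[xf xuv]]].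
have /andP[xy /negP[]] := N' x y xuv yL.
suff -> : [set x; y] = f by [].
apply/eqP; rewrite eqEcard cards2 xy Q2 // leqnn andbT.
by apply/subsetP=> z; rewrite !inE => /orP[] /eqP ->.
Qed.

(** Success requires every separated pair to avoid its failure event. At most [d] queried edges meet
    each end of a pair, hence the exponent [2 * d]. *)
Lemma pr_queries_find_le (R : realType) (p : R) Q d k :
  0 <= p -> p <= 1 -> {in Q, forall e, #|e| = 2} ->
  (k * (2 * d.+1) <= #|[set v | (degree Q v <= d)%N]|)%N ->
  pr_Gp p [set e : {set V} | #|e| == 2] (queries_find_maximal_matching Q)
    <= (1 - p * (1 - p) ^+ (2 * d)) ^+ k.
Proof.
move=> p0 p1 Q2 kL.
have [|s [<- sE sP]] := separated_nonedges Q d k _ Q2 _ kL.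
  by move=> v; rewrite inE.
pose F e := e |: edges_meeting Q e.
apply: le_trans (_ : pr_Gp p _ (fun S => all (fun e => S :&: F e != [set e]) s) <= _).
  apply: pr_Gp_le => // S; apply: contraLR => /allPn[e es].
  rewrite negbK => /eqP Se; have [u [v [euv uL vL uv eQ]]] := sE e es.
  apply: (@queries_fail _ _ e) => //.
    by have := set11 e; rewrite -Se inE => /andP[].
  by rewrite euv; apply/set0Pn; exists u; rewrite set21.
apply: pr_Gp_all_neq_set1 => // e es.
have [u [v [euv uL vL uv eQ]]] := sE e es; split.
- by rewrite setU11.
- rewrite subUset sub1set inE euv cards2 uv /=; apply/subsetP=> f.
  by rewrite !inE => /andP[/Q2 ->].
rewrite /F cardsU1 -add1n leq_add ?leq_b1 // euv.
apply: leq_trans (card_edges_meeting2 Q u v) _.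
by move: uL vL; rewrite !inE mul2n -addnn; apply: leq_add.
Qed.

End Matching.

(** * Estimates for powers and the choice of parameters *)

Lemma bernoulli (R : realFieldType) (t : R) n : 0 <= t -> 1 + n%:R * t <= (1 + t) ^+ n.
Proof.
move=> t0; elim: n => [|n IH]; first by rewrite mul0r addr0 expr0.
rewrite exprS -natr1; have : 0 <= n%:R * t by rewrite mulr_ge0.
by nra.
Qed.

(** The largest [d] with [b ^+ d <= x] exists because Bernoulli's inequality bounds such
    exponents. *)
Lemma exprn_bracket (R : realType) (b x : R) : 1 < b -> 1 <= x ->
  exists d, b ^+ d <= x < b ^+ d.+1.
Proof.
move=> b1 x1; have t0 : 0 < b - 1 by lra.
have exP : exists d, b ^+ d <= x by exists 0%N; rewrite expr0.
have ubP d : b ^+ d <= x -> (d <= Num.bound (x / (b - 1)))%N.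
  move=> bx; rewrite -(ler_nat R) ltW //.
  apply: le_lt_trans (archi_boundP _); last by rewrite divr_ge0 //; lra.
  rewrite ler_pdivlMr //; apply: le_trans bx.
  by have := @bernoulli R _ d (ltW t0); rewrite subrKC; lra.
have [d bd dmax] := ex_maxnP exP ubP; exists d; rewrite bd /= ltNge.
by apply/negP => /dmax; rewrite ltnn.
Qed.

(** Since [(1 - q) * (1 + q) <= 1], it suffices that [(1 + q) ^+ k] exceeds [1 / delta], which
    Bernoulli's inequality gives. *)
Lemma exprB1_lt (R : realFieldType) (q delta : R) k :
  0 <= q -> q <= 1 -> 0 < delta -> 1 <= delta * (k%:R * q) ->
  (1 - q) ^+ k < delta.
Proof.
move=> q0 q1 d0 dk; rewrite ltNge; apply/negP => dle.
have h1 : (1 - q) ^+ k * (1 + q) ^+ k <= 1.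
  by rewrite -exprMn exprn_ile1 //; nra.
have h2 := @bernoulli R q k q0.
suff : 1 < (1 - q) ^+ k * (1 + q) ^+ k by rewrite ltNge h1.
have h3 : delta * (1 + q) ^+ k <= (1 - q) ^+ k * (1 + q) ^+ k.
  by rewrite ler_wpM2r // exprn_ge0 //; lra.
by nra.
Qed.

(* delta is the level of the guarantee: for 0 < p < 1, delta = 1 says that every
   realization succeeds, and a guarantee with high probability implies the
   hypothesis for every fixed delta < 1 and all large n. *)
Theorem theorem7p2 (R : realType) (p delta : R)
    (hp0 : 0 < p) (hp1 : p < 1) (hdelta0 : 0 < delta) (hdelta1 : delta <= 1) :
  let b : R := 1 / (1 - p) in
  exists c : R, 0 < c /\
  exists n0 : nat, forall n : nat, (n0 <= n)%N ->
  exists G : {set {set 'I_n}}, simple_graph G /\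
  forall Q : {set {set 'I_n}}, Q \subset G ->
    delta <= pr_Gp p G (queries_find_maximal_matching Q) ->
    c * (n%:R * logb b n%:R) <= #|Q|%:R.
Proof.
(* With [logb b n < 4 (d + 1)], fewer than [n logb b n / 16] queries give a degree sum below
   [n (d + 1) / 2], so half of the vertices have degree at most [d]. *)
move=> b; exists (1 / 16); split; first by lra.
have p'0 : 0 < 1 - p by lra.
have b1 : 1 < b by rewrite /b ltr_pdivlMr //; lra.
have b0 : 0 < b by lra.
pose t := b - 1; have t0 : 0 < t by rewrite /t; lra.
(* Chosen so that [d + 1 <= K * b ^+ d], by Bernoulli's inequality. *)
pose K := 1 + 1 / t.
have tV : 0 < 1 / t by rewrite divr_gt0.
have K0 : 0 < K by rewrite /K; lra.
(* For [x > X0], the bound [x ^+ 3 <= 4 * K * (k + 1)] yields [k >= x ^+ 2 / (p * delta)]. *)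
pose X0 := 4 * K * (1 / (p * delta) + 1).
have pd0 : 0 < p * delta by rewrite mulr_gt0.
have X00 : 0 < X0.
  by rewrite /X0 !mulr_gt0 // addr_gt0 // divr_gt0.
(* As [n < (b * x) ^+ 4], this threshold forces [x > X0]. *)
exists (maxn 1 (Num.bound ((b * X0) ^+ 4))) => n.
rewrite geq_max => /andP[n1 nX].
have {}nX : (b * X0) ^+ 4 < n%:R.
  apply: lt_le_trans (archi_boundP _) _; first by rewrite exprn_ge0 // ltW // mulr_gt0.
  by rewrite ler_nat.
have n1R : 1 <= n%:R :> R by rewrite ler1n.
exists [set e : {set 'I_n} | #|e| == 2]; split.
  by apply/forallP => e; apply/implyP; rewrite inE.
move=> Q QG; apply: contraLR; rewrite -!ltNge => Qlt.
have Q2 : {in Q, forall e : {set 'I_n}, #|e| = 2}.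
  by move=> e /(subsetP QG); rewrite inE => /eqP.
have b41 : 1 < b ^+ 4 by rewrite exprn_egt1.
(* Base [b ^+ 4] makes [d] the integer part of [logb b n / 4]. *)
have [d] := exprn_bracket _ _ _ b41 n1R; rewrite -!exprM => /andP[bd bd1].
pose x := b ^+ d.
have x1 : 1 <= x by rewrite exprn_ege1 // ltW.
have x4 : x ^+ 4 <= n%:R by rewrite -exprM mulnC.
have xX0 : X0 < x.
  have : b * X0 < b * x.
    have bX0 : 0 <= b * X0 by rewrite mulr_ge0 // ltW.
    have bx0 : 0 <= b * x by rewrite mulr_ge0 ?ltW //; lra.
    rewrite -(@ltr_pXn2r _ 4) ?nnegrE //.
    by apply: lt_trans nX _; rewrite -exprS -exprM mulnC.
  by rewrite ltr_pM2l.
have d1 : d.+1%:R <= K * x.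
  have := @bernoulli R t d (ltW t0); rewrite /t subrKC -/x -/t => hd.
  rewrite -natr1; suff : d%:R <= 1 / t * x by rewrite /K; lra.
  rewrite mulrAC mul1r ler_pdivlMr //; lra.
have logd : logb b n%:R < 4 * d.+1%:R.
  have lnb : 0 < ln b by rewrite ln_gt0.
  rewrite /logb ltr_pdivrMr // -natrM mulr_natl -lnXn //.
  by rewrite ltr_ln ?posrE ?exprn_gt0 //; lra.
pose L := [set v | (degree Q v <= d)%N].
have nL : n%:R <= 2 * #|L|%:R :> R.
  have := @card_low_degree _ Q d Q2; rewrite card_ord -/L -(ler_nat R).
  rewrite natrD !natrM => hL.
  have d0 : 0 < d.+1%:R :> R by rewrite ltr0n.
  have : n%:R * logb b n%:R <= n%:R * (4 * d.+1%:R) by rewrite ler_wpM2l // ltW.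
  move=> nl; rewrite -(ler_pM2r d0); lra.
pose k := (#|L| %/ (2 * d.+1))%N.
have kL : #|L|%:R <= (k%:R + 1) * (2 * d.+1%:R) :> R.
  by rewrite natr1 -!natrM ler_nat ltnW // ltn_ceil.
apply: le_lt_trans (@pr_queries_find_le _ R p Q d k (ltW hp0) (ltW hp1) Q2 _) _.
  exact: leq_divM.
have pb : 1 - p = b^-1 by rewrite /b div1r invrK.
have -> : (1 - p) ^+ (2 * d) = (x ^+ 2)^-1 by rewrite pb exprVn mulnC exprM.
have x20 : 0 < x ^+ 2 by rewrite exprn_gt0 //; lra.
apply: exprB1_lt => //.
- by rewrite divr_ge0 // ltW.
- by rewrite ler_pdivrMr // mul1r expr2; nra.
(* Chain [x ^+ 4 <= n <= 2 * #|L| <= 4 * (k + 1) * (d + 1)] with [d + 1 <= K * x], then cancel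
   [x]. *)
have kx : x ^+ 3 <= 4 * K * (k%:R + 1).
  have x0 : 0 < x by lra.
  rewrite -(ler_pM2r x0) -exprSr; apply: le_trans x4 _.
  have : (k%:R + 1) * d.+1%:R <= (k%:R + 1) * (K * x) by rewrite ler_wpM2l // addr_ge0.
  lra.
have kq : 1 / (p * delta) * x ^+ 2 <= k%:R.
  have K40 : 0 < 4 * K by lra.
  rewrite -(ler_pM2l K40).
  have h : X0 * x ^+ 2 <= x * x ^+ 2 by rewrite ler_wpM2r // ltW.
  have h' : 4 * K <= 4 * K * x ^+ 2 by rewrite ler_peMr ?(ltW K40) // exprn_ege1.
  by move: h; rewrite /X0 -exprS; lra.
have -> : delta * (k%:R * (p / x ^+ 2)) = p * delta * k%:R / x ^+ 2 by ring.
rewrite ler_pdivlMr // mul1r.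
by move: kq; rewrite mulrAC mul1r ler_pdivrMr // mulrC.
Qed.
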